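(* Let $\mathcal{X}$ be a Euclidean space, let $\mathcal{G}\subset\mathcal{O}(\mathcal{X})$ be a compact subgroup, let $C\subseteq\mathcal{X}$ be a nonempty closed convex set, and let $\mathcal{M}$ be the collection of all expofam-type estimators on $\mathcal{X}$ with a $\mathcal{G}$-invariant generator and penalty support set $C$. For each $x\in\mathcal{X}$, suppose that $Q_x:\mathcal{X}\to\mathcal{X}$ is an orthogonal projection satisfying 1. (averaging) $Q_xu\preceq_{\mathcal{G}}u$ for all $u\in\mathcal{X}$, 2. (dual feasibility) $Q_x(x-C)\subseteq x-C$, and 3. (dual invariance) $Q_x(x-C)\subseteq Q_xx-C$. Then the function $R(x)=Q_xx$ is computationally sufficient for $\mathcal{M}$.
   Context: $\mathcal{X}$ has inner product $\langle\cdot,\cdot\rangle$; $\mathcal{O}(\mathcal{X})$ is its orthogonal group; $\mathcal{G}$ acts linearly on $\mathcal{X}$, written $g\cdot x$. A function $f$ on $\mathcal{X}$ is $\mathcal{G}$-invariant if $f(g\cdot x)=f(x)$ for all $x\in\mathcal{X}$, $g\in\mathcal{G}$. The relation $v\preceq_{\mathcal{G}}u$ means $v\in\operatorname{conv}(\mathcal{G}\cdot u)$, where $\mathcal{G}\cdot u=\{g\cdot u:g\in\mathcal{G}\}$. Expofam-type estimator: a set-valued function on $\mathcal{X}$ of the form $T(x)=\operatorname{arg\,min}_{\theta\in\mathcal{X}}A(\theta)-\langle x,\theta\rangle+h_C(\theta)$ (the set of minimizers, possibly empty or with several elements), where the generator $A:\mathcal{X}\to\mathbb{R}\cup\{+\infty\}$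 is closed (lower semicontinuous), convex and proper (finite at some point), $C$ is a nonempty closed convex set (the penalty support set), and $h_C(\theta)=\sup_{z\in C}\langle z,\theta\rangle\in\mathbb{R}\cup\{+\infty\}$. Computational sufficiency: for a collection $\mathcal{M}$ of set-valued functions on $\mathcal{X}$, let $\operatorname{dom}T=\{x\in\mathcal{X}:T(x)\neq\emptyset\}$. A function $R$ on $\mathcal{X}$ is computationally sufficient for $\mathcal{M}$ if for each $T\in\mathcal{M}$ there exists a set-valued function $f$ such that $f(T,R(x))\neq\emptyset$ for all $x\in\operatorname{dom}T$ and $f(T,R(x))\subseteq T(x)$ for all $x\in\mathcal{X}$. For a set $S\subseteq\mathcal{X}$: $QS=\{Qs:s\in S\}$ and $x-S=\{x-s:s\in S\}$. *)

(* Defs.v *)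
From HB Require Import structures.
From mathcomp Require Import all_boot all_order all_algebra.
From mathcomp Require Import all_classical all_reals all_analysis.

Set Implicit Arguments.
Unset Strict Implicit.
Unset Printing Implicit Defensive.

Import Order.TTheory GRing.Theory Num.Theory.
Import numFieldNormedType.Exports.

Local Open Scope classical_set_scope.
Local Open Scope ring_scope.

(* Finite-dimensional normed spaces.  A Euclidean space is such a space E with
   an inner product ip : {dot E for idfun} that induces its norm. *)
#[short(type="normedVectType")]
HB.structure Definition NormedVect (R : numFieldType) :=
  {E of NormedModule R E & Vector R E}.

Definition norm_induced_by (R : realType) (X : normedVectType R)
    (ip : {dot X for idfun}) : Prop :=
  forall x : X, `|x| = Num.sqrt (ip x x).

Definition orthogonal_subgroup (R : realType) (X : normedVectType R)
    (ip : {dot X for idfun}) (G : set 'End(X)) : Prop :=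
  [/\ forall g, G g -> isometry ip ip g,
      G \1%VF,
      forall g h, G g -> G h -> G (g \o h)%VF &
      forall g, G g -> G (g^-1)%VF].

(* 'End(X) carries no topology in the library.  Since X is finite dimensional,
   its usual topology is that of pointwise convergence. *)
Definition compact_endomorphisms (R : realType) (X : normedVectType R)
    (G : set 'End(X)) : Prop :=
  compact ([set (g : X -> X) | g in G] : set {ptws X -> X}).

Definition orbit_of (R : realType) (X : normedVectType R)
    (G : set 'End(X)) (u : X) : set X :=
  [set g u | g in G].

Definition conv_hull (R : realType) (X : normedVectType R) (S : set X) : set X :=
  smallest (@convex_set R X) S.

Definition group_majorized (R : realType) (X : normedVectType R)
    (G : set 'End(X)) (v u : X) : Prop :=
  conv_hull (orbit_of G u) v.

Definition group_invariant (R : realType) (X : normedVectType R) (Y : Type)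
    (G : set 'End(X)) (f : X -> Y) : Prop :=
  forall (g : 'End(X)) (x : X), G g -> f (g x) = f x.

(* The endpoints t = 0, 1 are harmless, as 0 * +oo = 0 in \bar R. *)
Definition ereal_convex (R : realType) (X : normedVectType R)
    (A : X -> \bar R) : Prop :=
  forall (x y : X) (t : R), 0 <= t <= 1 ->
    (A (t *: x + (1 - t) *: y)%R <= t%:E * A x + (1 - t)%:E * A y)%E.

Definition generator (R : realType) (X : normedVectType R)
    (A : X -> \bar R) : Prop :=
  [/\ forall x, A x != -oo%E,
      exists x, A x \is a fin_num,
      ereal_convex A &
      lower_semicontinuous A].

Definition support_function (R : realType) (X : normedVectType R)
    (ip : {dot X for idfun}) (C : set X) (theta : X) : \bar R :=
  ereal_sup [set (ip z theta)%:E | z in C].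

Definition argmin (R : realType) (X : Type) (F : X -> \bar R) : set X :=
  [set theta | forall eta, (F theta <= F eta)%E].

Definition expofam_estimator (R : realType) (X : normedVectType R)
    (ip : {dot X for idfun}) (A : X -> \bar R) (C : set X) (x : X) : set X :=
  argmin (fun theta =>
    (A theta - (ip x theta)%:E + support_function ip C theta)%E).

Definition invariant_expofam (R : realType) (X : normedVectType R)
    (ip : {dot X for idfun}) (G : set 'End(X)) (C : set X) :
    set (X -> set X) :=
  [set T | exists A : X -> \bar R,
     [/\ generator A, group_invariant G A & T = expofam_estimator ip A C]].

Definition estimator_dom (X : Type) (T : X -> set X) : set X :=
  [set x | T x !=set0].

Definition computationally_sufficient (X Y : Type)
    (M : set (X -> set X)) (R : X -> Y) : Prop :=
  forall T, M T ->
    exists f : (X -> set X) -> Y -> set X,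
      (forall x, estimator_dom T x -> f T (R x) !=set0) /\
      (forall x, f T (R x) `<=` T x).

Definition orthogonal_projection (R : realType) (X : normedVectType R)
    (ip : {dot X for idfun}) (Q : X -> X) : Prop :=
  exists V : {vspace X}, forall u, Q u \in V /\ u - Q u \in orthov ip V.

Definition sub_set (R : realType) (X : normedVectType R) (x : X) (S : set X) :
    set X :=
  [set x - s | s in S].

(* Main.v *)
Require Import Defs.
From HB Require Import structures.
From mathcomp Require Import all_boot all_order all_algebra.
From mathcomp Require Import all_classical all_reals all_analysis.

From mathcomp Require Import ring.

Set Implicit Arguments.
Unset Strict Implicit.
Unset Printing Implicit Defensive.

Import Order.TTheory GRing.Theory Num.Theory.
Import VectorInternalTheory numFieldNormedType.Exports.

Local Open Scope classical_set_scope.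
Local Open Scope ring_scope.

(** Write F_x(theta) = A theta - <x, theta> + h_C(theta), so that T(x) is the set
    of minimizers of F_x, and let r = Q_x x.

    The three assumptions make the problems at x and at r equivalent through
    Q_x: for every theta,
      F_x(Q_x theta) <= F_r(theta)   and   F_r(Q_x theta) <= F_x(theta)
    ([objective_projection_le] and [objective_reduced_le]).  Indeed averaging
    gives A(Q_x theta) <= A theta, since the sublevel sets of A are convex and
    G-invariant; and the linear part of F_x is the supremum of - <s, theta> over
    s in x - C, so that, Q_x being self-adjoint, applying Q_x to theta amounts
    to applying it to x - C, which lands in r - C by dual invariance and in
    x - C by dual feasibility.  Hence Q_x maps T(x) into T(r) and T(r) into
    T(x).

    It remains to choose, from r alone, a point that lies in T(x) for all x with
    Q_x x = r at once; the images under Q_x of one point of T(r) do not do,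
    because Q_x depends on x.  A point theta of minimal norm in T(r) does: Q_x
    maps T(r) into itself and does not increase the norm, so |Q_x theta| =
    |theta|, hence Q_x theta = theta, and this point is in T(x).  Such a theta
    exists because T(r) is closed and the space is finite dimensional
    ([expofam_estimator_closed] and [closed_min_norm]). *)

(** * Closed sets in a finite-dimensional normed space *)

Lemma r2v_continuous (R : realType) (X : normedVectType R) :
  continuous (r2v : 'rV[R]_(dim X) -> X).
Proof.
have -> : (r2v : 'rV[R]_(dim X) -> X) =
    fun c => \sum_i c 0 i *: r2v (delta_mx 0 i).
  apply/funext => c; rewrite {1}(row_sum_delta c) linear_sum /=.
  by apply: eq_bigr => i _; rewrite linearZ.
apply: continuous_big => [|i _]; first exact: add_continuous.
by move=> c; apply: (@cvgZr_tmp _ _ _ (nbhs c)); exact: coord_continuous.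
Qed.

Lemma norm_r2v_continuous (R : realType) (X : normedVectType R) :
  continuous (fun c : 'rV[R]_(dim X) => `|r2v c : X|).
Proof.
by move=> c; apply: (@cvg_norm _ _ _ (nbhs c)); exact: r2v_continuous.
Qed.

(** Half of the equivalence of norms in finite dimension: |r2v c| has a positive
    minimum on the compact unit sphere, and homogeneity does the rest. *)
Lemma r2v_norm_lower_bound (R : realType) (X : normedVectType R) :
  exists2 k : R, 0 < k & forall c : 'rV[R]_(dim X), k * `|c| <= `|r2v c : X|.
Proof.
pose S := [set c : 'rV[R]_(dim X) | `|c| = 1].
have r2v0 : r2v 0 = 0 :> X by rewrite linear0.
have [S0|/set0P S_neq0] := eqVneq S set0.
  (* The sphere is empty only in dimension 0, where c = 0. *)
  exists 1 => // c; have [->|c0] := eqVneq c 0; first by rewrite normr0 mulr0.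
  suff : S (`|c|^-1 *: c) by rewrite S0.
  by rewrite /S/= normrZ normfV normr_id mulVf// normr_eq0.
have S_compact : compact S.
  apply: bounded_closed_compact.
    by exists 1; split => // M M1 c /= ->; exact: ltW.
  rewrite (_ : S = Num.norm @^-1` [set 1])//.
  apply: preimage_closed; first by move=> c _; exact: norm_continuous.
  exact: closed_eq.
have [|c cS cmin] := @EVT_min_rV R _ (fun c => `|r2v c : X|) S S_neq0 S_compact.
  by apply: continuous_subspaceT; exact: norm_r2v_continuous.
exists `|r2v c : X|.
  rewrite normr_gt0; apply/eqP => rc0; move: cS; rewrite inE /S/=.
  have -> : c = 0 by apply: (@r2v_inj _ X); rewrite rc0 r2v0.
  by rewrite normr0 => /esym/eqP; rewrite oner_eq0.
move=> d; have [->|d0] := eqVneq d 0; first by rewrite normr0 mulr0.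
have dgt0 : 0 < `|d| by rewrite normr_gt0.
rewrite -ler_pdivlMr//.
have -> : `|r2v d : X| / `|d| = `|r2v (`|d|^-1 *: d) : X|.
  by rewrite linearZ normrZ normfV normr_id mulrC.
by apply: cmin; rewrite inE /S/= normrZ normfV normr_id mulVf// normr_eq0.
Qed.

(** Only the part of S in the ball of radius |s0| matters, for some s0 in S; by
    the lower bound on |r2v c| its coordinates form a compact set. *)
Lemma closed_min_norm (R : realType) (X : normedVectType R) (S : set X) :
  closed S -> S !=set0 -> exists2 s, S s & forall t, S t -> `|s| <= `|t|.
Proof.
move=> S_closed [s0 Ss0].
have [k k0 kP] := r2v_norm_lower_bound X.
pose N c := `|r2v c : X|.
have N_cont : continuous N by exact: norm_r2v_continuous.
pose K := (r2v @^-1` S) `&` (N @^-1` [set y | y <= `|s0|]).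
have K_compact : compact K.
  apply: bounded_closed_compact.
    exists (`|s0| / k); split => [|M Mk c [_ /= Nc]]; first exact: num_real.
    rewrite (le_trans _ (ltW Mk))// ler_pdivlMr// mulrC.
    exact: le_trans (kP c) Nc.
  apply: closedI; apply: preimage_closed.
  - by move=> c _; exact: r2v_continuous.
  - exact: S_closed.
  - by move=> c _; exact: N_cont.
  - exact: closed_le.
have K0 : K !=set0 by exists (v2r s0); split; rewrite /= /N v2rK.
have [|c] := @EVT_min_rV R _ N K K0 K_compact.
  by apply: continuous_subspaceT; exact: N_cont.
rewrite inE => -[Sc Nc] cmin; exists (r2v c) => // t St.
have [ts|/ltW st] := leP `|t| `|s0|; last exact: le_trans Nc st.
have := cmin (v2r t); rewrite /N v2rK; apply.
by rewrite inE; split; rewrite /= /N v2rK.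
Qed.

(** * Semicontinuity and the inner product *)

Lemma lower_semicontinuous_sublevel_closed (R : realType)
    (X : topologicalType) (A : X -> \bar R) (g : X -> R) (c : \bar R) :
  lower_semicontinuous A -> (forall x, A x != -oo%E) -> continuous g ->
  closed [set x | (A x + (g x)%:E <= c)%E].
Proof.
move=> A_lsc A_Noo g_cont.
rewrite -[X in closed X]setCK; apply: open_closedC; rewrite openE => x /=.
move/negP; rewrite -ltNge => c_lt.
rewrite /interior; suff : \forall y \near x, (c < A y + (g y)%:E)%E.
  by apply: filterS => y /=; rewrite ltNge => /negP.
case: c c_lt => [c c_lt||_]; first 1 last.
- by rewrite ltNge leey.
- by apply: nearW => y; rewrite ltNye adde_eq_ninfty negb_or A_Noo.
(* A value b strictly between c - g x and A x splits the strict inequality at x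
   into one for A and one for g, each of which persists near x. *)
have [b cb bA] : exists2 b : R, c - g x < b & (b%:E < A x)%E.
  move: c_lt (A_Noo x); case: (A x) => [a|_|//].
    rewrite -EFinD lte_fin => c_lt _; exists ((c - g x + a) / 2).
      by rewrite midf_lt// ltrBlDr.
    by rewrite lte_fin midf_lt// ltrBlDr.
  by exists (c - g x + 1); rewrite ?ltrDl ?ltry.
have [V xV VA] := A_lsc _ _ bA.
have gx : \forall y \near x, c - b < g y.
  by apply: (cvgr_gt (g x)); [exact: g_cont | rewrite ltrBlDr addrC -ltrBlDr].
near=> y.
have Vy : (b%:E < A y)%E by apply: VA; near: y.
have cgy : c - b < g y by near: y.
rewrite (@le_lt_trans _ _ (b%:E + (c - b)%:E)%E)//.
  by rewrite -EFinD lee_fin subrKC.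
by rewrite lteD// lte_fin.
Unshelve. all: by end_near. Qed.

Lemma dot_ge0 (R : realType) (X : normedVectType R) (ip : {dot X for idfun})
    (w : X) : 0 <= ip w w.
Proof.
have [->|w0] := eqVneq w 0; first by rewrite linear0r.
exact/ltW/neq0_dnorm_gt0.
Qed.

(** By polarization, the inner product is a polynomial in norms. *)
Lemma dot_continuous (R : realType) (X : normedVectType R)
    (ip : {dot X for idfun}) (w : X) :
  norm_induced_by ip -> continuous (ip w).
Proof.
move=> ip_norm.
have ip_sqr x : ip x x = `|x| ^+ 2.
  by rewrite ip_norm sqr_sqrtr// dot_ge0.
have -> : ip w = fun v : X => 2^-1 * (`|w + v| ^+ 2 - `|w| ^+ 2 - `|v| ^+ 2).
  apply/funext => v; rewrite -!ip_sqr.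
  rewrite linearDl !linearDr /= (hermC ip v w) expr0 mul1r /=.
  by field.
move=> v; have normv : `|x| @[x --> v] --> `|v| by exact: norm_continuous.
have normwv : `|w + x| @[x --> v] --> `|w + v|.
  by apply: cvg_norm; apply: cvgD => //; exact: cvg_cst.
apply: cvgMl_tmp; apply: cvgB; last exact: (cvgM normv normv).
by apply: cvgB; [exact: (cvgM normwv normwv) | exact: cvg_cst].
Qed.

(** * Orthogonal projections *)

Lemma orthogonal_projection_selfadjoint (R : realType) (X : normedVectType R)
    (ip : {dot X for idfun}) (P : X -> X) (u v : X) :
  orthogonal_projection ip P -> ip (P u) v = ip u (P v).
Proof.
move=> [V PV].
have [Pu /mem_orthovP uP] := PV u; have [Pv /mem_orthovP vP] := PV v.
transitivity (ip (P u) (P v)); apply/eqP; rewrite -subr_eq0.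
  by rewrite -linearBr/= hermC vP// mulr0.
by rewrite -oppr_eq0 opprB -linearBl/= uP.
Qed.

Lemma orthogonal_projection_idempotent (R : realType) (X : normedVectType R)
    (ip : {dot X for idfun}) (P : X -> X) (u : X) :
  orthogonal_projection ip P -> P (P u) = P u.
Proof.
move=> [V PV]; have [Pu _] := PV u; have [PPu /mem_orthovP PuP] := PV (P u).
apply/eqP; rewrite eq_sym -subr_eq0; apply/negPn/negP.
by move/(neq0_dnorm_gt0 (s := ip)); rewrite PuP ?ltxx// rpredB.
Qed.

(** The equality case of |P u| <= |u|: by Pythagoras |u|^2 exceeds |P u|^2 by
    |u - P u|^2. *)
Lemma orthogonal_projection_fixed (R : realType) (X : normedVectType R)
    (ip : {dot X for idfun}) (P : X -> X) (u : X) :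
  norm_induced_by ip -> orthogonal_projection ip P ->
  `|u| <= `|P u| -> P u = u.
Proof.
move=> ip_norm P_proj; have [V PV] := P_proj.
have [Pu /mem_orthovP uP] := PV u.
rewrite !ip_norm ler_sqrt ?dot_ge0// => uPu; apply/eqP; rewrite eq_sym -subr_eq0.
apply/negPn/negP => /(neq0_dnorm_gt0 (s := ip)); rewrite ltNge => /negP; apply.
have := @hnormDd _ _ _ _ ip _ _ (uP _ Pu).
by rewrite subrK => uE; move: uPu; rewrite uE gerDr.
Qed.

(** * The objective function *)

(** The set where A is at most A u is convex and contains the orbit of u, hence
    the convex hull of that orbit. *)
Lemma invariant_averaging_le (R : realType) (X : normedVectType R)
    (G : set 'End(X)) (A : X -> \bar R) (u v : X) :
  ereal_convex A -> group_invariant G A -> group_majorized G v u ->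
  (A v <= A u)%E.
Proof.
move=> A_convex A_inv.
suff sub : conv_hull (orbit_of G u) `<=` [set w | (A w <= A u)%E].
  by move=> /sub.
apply: smallest_sub => [x y t|_ [g Gg <-]]; last by rewrite /= A_inv.
rewrite !inE /= => Ax Ay; apply: le_trans (A_convex x y t%:num _) _.
  by rewrite ge0 le1.
apply: (@le_trans _ _ (t%:num%:E * A u + (1 - t%:num)%:E * A u)%E).
  by apply: leeD; apply: lee_wpmul2l; rewrite ?lee_fin ?subr_ge0.
by rewrite -ge0_muleDl ?lee_fin ?subr_ge0// -EFinD subrKC mul1e.
Qed.

Definition objective (R : realType) (X : normedVectType R)
    (ip : {dot X for idfun}) (A : X -> \bar R) (C : set X) (x theta : X) :=
  (A theta - (ip x theta)%:E + support_function ip C theta)%E.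

(** Pulls the supremum in h_C out of the sum, which reduces comparisons of
    objectives to comparisons of their affine pieces.  The case A theta = +oo is
    where nonemptiness of C is used: otherwise h_C = -oo and the sum is -oo. *)
Lemma objective_leP (R : realType) (X : normedVectType R)
    (ip : {dot X for idfun}) (A : X -> \bar R) (C : set X) (x theta : X)
    (c : \bar R) :
  C !=set0 -> (forall u, A u != -oo%E) ->
  (objective ip A C x theta <= c)%E <->
  (forall z, C z -> (A theta + (ip (z - x) theta)%:E <= c)%E).
Proof.
move=> [z0 Cz0] A_Noo; rewrite /objective /support_function.
set h := ereal_sup _.
have ipB z : ip (z - x) theta = ip z theta - ip x theta by rewrite linearBl.
have h_ub z : C z -> ((ip z theta)%:E <= h)%E.
  by move=> Cz; apply: ereal_sup_ubound; exists z.
case AE: (A theta) (A_Noo theta) => [a|//|//] _; last first.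
  have hNoo : h != -oo%E by rewrite -ltNye (lt_le_trans _ (h_ub _ Cz0))// ltNyr.
  by rewrite !addye//; split=> [//|/(_ _ Cz0)]; rewrite addye.
rewrite -EFinN -EFinD -leeBrDl//; split=> [hc z Cz|hc].
  move: (le_trans (h_ub _ Cz) hc); rewrite leeBrDl//.
  by rewrite -!EFinD ipB addrA addrAC.
apply: ge_ereal_sup => _ [z Cz <-]; rewrite leeBrDl//.
by have := hc z Cz; rewrite -!EFinD ipB addrA addrAC.
Qed.

(** The set of minimizers is an intersection of sublevel sets of the functions
    A + <z - x, .>. *)
Lemma expofam_estimator_closed (R : realType) (X : normedVectType R)
    (ip : {dot X for idfun}) (A : X -> \bar R) (C : set X) (x : X) :
  norm_induced_by ip -> C !=set0 -> generator A ->
  closed (expofam_estimator ip A C x).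
Proof.
move=> ip_norm C_neq0 [A_Noo _ _ A_lsc].
rewrite (_ : expofam_estimator _ _ _ _ = \bigcap_eta \bigcap_(z in C)
    [set theta | (A theta + (ip (z - x) theta)%:E <= objective ip A C x eta)%E]).
  apply: closed_bigI => eta _; apply: closed_bigI => z _.
  apply: lower_semicontinuous_sublevel_closed => //.
  exact: dot_continuous.
apply/seteqP; split=> theta.
  move=> Ttheta eta _ z Cz.
  exact: (objective_leP _ _ _ _ C_neq0 A_Noo).1 (Ttheta eta) z Cz.
move=> Ttheta eta; apply: (objective_leP _ _ _ _ C_neq0 A_Noo).2 => z Cz.
exact: Ttheta.
Qed.

(** * Passing from x to its projection *)

Section Reduction.
Context (R : realType) (X : normedVectType R) (ip : {dot X for idfun})
  (G : set 'End(X)) (A : X -> \bar R) (C : set X) (x : X) (P : X -> X)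
  (C_neq0 : C !=set0) (A_gen : generator A) (A_inv : group_invariant G A)
  (P_proj : orthogonal_projection ip P)
  (P_averaging : forall u, group_majorized G (P u) u)
  (P_feasible : P @` sub_set x C `<=` sub_set x C)
  (P_invariant : P @` sub_set x C `<=` sub_set (P x) C).

Let A_Noo : forall u, A u != -oo%E. Proof. by case: A_gen. Qed.

Let A_P_le u : (A (P u) <= A u)%E.
Proof.
by apply: (invariant_averaging_le _ A_inv (@P_averaging u)); case: A_gen.
Qed.

Let dot_shift z theta : ip (z - x) (P theta) = - ip (P (x - z)) theta.
Proof.
by rewrite -opprB linearNl (orthogonal_projection_selfadjoint _ _ P_proj).
Qed.

(** Dual invariance writes P (x - z) as P x - z' with z' in C, so that the piece
    of the left objective at z is dominated by the piece of the right one at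
    z'. *)
Lemma objective_projection_le theta :
  (objective ip A C x (P theta) <= objective ip A C (P x) theta)%E.
Proof.
apply: (objective_leP _ _ _ _ C_neq0 A_Noo).2 => z Cz.
have [|z' Cz' z'E] := @P_invariant (P (x - z)).
  by exists (x - z) => //; exists z.
apply: le_trans ((objective_leP _ _ _ _ C_neq0 A_Noo).1 (lexx _) z' Cz').
by rewrite dot_shift -z'E -linearNl opprB leeD2r.
Qed.

(** Dual feasibility writes P (x - z) as x - z' with z' in C.  The shift by P x
    on the left may be replaced by x, as both have the same inner product with
    the fixed vector P theta. *)
Lemma objective_reduced_le theta :
  (objective ip A C (P x) (P theta) <= objective ip A C x theta)%E.
Proof.
apply: (objective_leP _ _ _ _ C_neq0 A_Noo).2 => z Cz.
have [|z' Cz' z'E] := @P_feasible (P (x - z)).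
  by exists (x - z) => //; exists z.
apply: le_trans ((objective_leP _ _ _ _ C_neq0 A_Noo).1 (lexx _) z' Cz').
have -> : ip (z - P x) (P theta) = ip (z - x) (P theta).
  rewrite !linearBl/= (orthogonal_projection_selfadjoint _ _ P_proj).
  by rewrite (orthogonal_projection_idempotent _ P_proj).
by rewrite dot_shift -z'E -linearNl opprB leeD2r.
Qed.

Lemma expofam_estimator_reduce theta :
  expofam_estimator ip A C x theta ->
  expofam_estimator ip A C (P x) (P theta).
Proof.
move=> Ttheta eta; apply: le_trans (objective_reduced_le theta) _.
exact: le_trans (Ttheta (P eta)) (objective_projection_le eta).
Qed.

Lemma expofam_estimator_lift theta :
  expofam_estimator ip A C (P x) theta ->
  expofam_estimator ip A C x (P theta).
Proof.
move=> Ttheta eta; apply: le_trans (objective_projection_le theta) _.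
exact: le_trans (Ttheta (P eta)) (objective_reduced_le eta).
Qed.

(** P theta is in both T(x) and T(P x); minimality of |theta| in the latter
    forces P theta = theta. *)
Lemma min_norm_estimator theta : norm_induced_by ip ->
  expofam_estimator ip A C (P x) theta ->
  (forall eta, expofam_estimator ip A C (P x) eta -> `|theta| <= `|eta|) ->
  expofam_estimator ip A C x theta.
Proof.
move=> ip_norm Ttheta theta_min.
have TP := expofam_estimator_lift Ttheta.
have TPP := expofam_estimator_reduce TP.
rewrite (orthogonal_projection_idempotent _ P_proj) in TPP.
by rewrite -(orthogonal_projection_fixed ip_norm P_proj (theta_min _ TPP)).
Qed.

End Reduction.

Theorem corollary2 (R : realType) (X : normedVectType R)
    (ip : {dot X for idfun}) (ip_norm : norm_induced_by ip)
    (G : set 'End(X)) (G_sub : orthogonal_subgroup ip G)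
    (G_compact : compact_endomorphisms G)
    (C : set X) (C_neq0 : C !=set0) (C_closed : closed C)
    (C_convex : @convex_set R X C)
    (Q : X -> X -> X)
    (Q_proj : forall x, orthogonal_projection ip (Q x))
    (averaging : forall x u, group_majorized G (Q x u) u)
    (dual_feasibility : forall x, Q x @` sub_set x C `<=` sub_set x C)
    (dual_invariance : forall x, Q x @` sub_set x C `<=` sub_set (Q x x) C) :
  computationally_sufficient (invariant_expofam ip G C) (fun x => Q x x).
Proof.
move=> _ [A [A_gen A_inv ->]].
exists (fun T r => [set theta | T r theta /\
  forall eta, T r eta -> `|theta| <= `|eta|]).
split=> [x [theta Ttheta]|x theta [Ttheta theta_min]].
  have T_neq0 : expofam_estimator ip A C (Q x x) !=set0.
    by exists (Q x theta); exact: (expofam_estimator_reduce C_neq0 A_gen A_inv (Q_proj x)).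
  have T_closed := expofam_estimator_closed (x := Q x x) ip_norm C_neq0 A_gen.
  by have [t Tt t_min] := closed_min_norm T_closed T_neq0; exists t.
exact: (min_norm_estimator C_neq0 A_gen A_inv (Q_proj x)).
Qed.
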